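(* Let $L(m,n)=3\frac{m^2+m}{2}+2nm+n^2+n$. Then, as formal power series in $x,q$, \[ \sum_{\pi\in\ell\mathcal{G}_1}x^{\#(\pi)}q^{|\pi|}=\sum_{m,n\ge0}\frac{x^{m+n}q^{L(m,n)}}{(q;q)_m(q^4;q^4)_{\lfloor n/2\rfloor}}+\sum_{m,n\ge0}\frac{x^{m+n+1}q^{L(m,n)+2m+2n+1}}{(q;q)_m(q^4;q^4)_{\lfloor n/2\rfloor}}, \] \[ \sum_{\pi\in\ell\mathcal{G}_2}x^{\#(\pi)}q^{|\pi|}=\sum_{m,n\ge0}\frac{x^{m+n}q^{L(m,n)}}{(q;q)_m(q^4;q^4)_{\lfloor n/2\rfloor}}. \]
   Context: A partition is a finite non-decreasing sequence $\pi=(\lambda_1,\dots,\lambda_{\#(\pi)})$ of positive integers (the empty sequence is the unique partition of $0$); $\#(\pi)$ is its number of parts and $|\pi|$ the sum of its parts. For $i=1,2$, $\ell\mathcal{G}_i$ is the set of partitions all of whose parts are $\ge i$, with $\lambda_j-\lambda_{j-1}\ge2$ for $j\ge2$ and no two consecutive odd parts, i.e. $\lambda_j-\lambda_{j-1}\ge3$ whenever $\lambda_j$ is odd. $(a;q)_k=\prod_{i=0}^{k-1}(1-aq^i)$. *)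

(* Defs.v *)
From HB Require Import structures.
From mathcomp Require Import all_boot all_order all_algebra.
From mathcomp Require Import boolp classical_sets functions cardinality fsbigop.

Set Implicit Arguments.
Unset Strict Implicit.
Unset Printing Implicit Defensive.

Import Order.TTheory GRing.Theory Num.Theory.
Local Open Scope ring_scope.

(* Formal power series over R; f n is the coefficient of degree n. *)
Record fps (R : Type) := FPS { fps_coef : nat -> R }.
Coercion fps_coef : fps >-> Funclass.
Notation "{ 'fps' R }" := (fps R) (format "{ 'fps'  R }") : type_scope.

HB.instance Definition _ (R : Type) := gen_eqMixin {fps R}.
HB.instance Definition _ (R : Type) := gen_choiceMixin {fps R}.

Lemma fpsP (R : Type) (f g : {fps R}) : (forall n, f n = g n) -> f = g.
Proof.
by case: f g => [f] [g] /= fg; congr FPS; apply/funext.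
Qed.

Section FpsRing.
Variable R : comNzRingType.
Implicit Types f g h : {fps R}.

Definition fps_zero : {fps R} := FPS (fun=> 0).
Definition fps_one : {fps R} := FPS (fun n => (n == 0)%:R).
Definition fps_opp f : {fps R} := FPS (fun n => - f n).
Definition fps_add f g : {fps R} := FPS (fun n => f n + g n).
Definition fps_mul f g : {fps R} :=
  FPS (fun n => \sum_(i < n.+1) f i * g (n - i)%N).

Fact fps_addA : associative fps_add.
Proof. by move=> f g h; apply: fpsP => n /=; rewrite addrA. Qed.
Fact fps_addC : commutative fps_add.
Proof. by move=> f g; apply: fpsP => n /=; rewrite addrC. Qed.
Fact fps_add0 : left_id fps_zero fps_add.
Proof. by move=> f; apply: fpsP => n /=; rewrite add0r. Qed.
Fact fps_addN : left_inverse fps_zero fps_opp fps_add.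
Proof. by move=> f; apply: fpsP => n /=; rewrite addNr. Qed.

HB.instance Definition _ :=
  GRing.isZmodule.Build {fps R} fps_addA fps_addC fps_add0 fps_addN.

Definition fps_trunc N f : {poly R} := \poly_(i < N) f i.

Lemma fps_mul_trunc N f g n : (n < N)%N ->
  fps_mul f g n = (fps_trunc N f * fps_trunc N g)`_n.
Proof.
move=> nN; rewrite coefM /=; apply: eq_bigr => i _; rewrite !coef_poly.
by rewrite !ifT // ?(leq_ltn_trans (leq_subr _ _) nN) //
           (leq_ltn_trans _ nN) // -ltnS.
Qed.

Fact fps_mulC : commutative fps_mul.
Proof.
move=> f g; apply: fpsP => n.
by rewrite !(@fps_mul_trunc n.+1) // mulrC.
Qed.

Fact fps_mulA : associative fps_mul.
Proof.
move=> f g h; apply: fpsP => n.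
have E (u v w : {fps R}) : fps_mul u (fps_mul v w) n =
    (fps_trunc n.+1 u * (fps_trunc n.+1 v * fps_trunc n.+1 w))`_n.
  rewrite coefM [LHS]/=; apply: eq_bigr => i _.
  have lt_i : (n - i < n.+1)%N by rewrite ltnS leq_subr.
  by rewrite -[in RHS]fps_mul_trunc // coef_poly ltn_ord.
by rewrite [in RHS]fps_mulC !E [in RHS]mulrC mulrA.
Qed.

Fact fps_mul1 : left_id fps_one fps_mul.
Proof.
move=> f; apply: fpsP => n /=; rewrite big_ord_recl /= mul1r subn0.
by rewrite big1 ?addr0 // => i _; rewrite mul0r.
Qed.

Fact fps_mulDl : left_distributive fps_mul fps_add.
Proof.
move=> f g h; apply: fpsP => n /=; rewrite -big_split /=.
by apply: eq_bigr => i _; rewrite mulrDl.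
Qed.

Fact fps_one_neq0 : fps_one != 0.
Proof.
apply/eqP => /(congr1 (fun f : {fps R} => f 0%N)) /= /eqP.
by rewrite oner_eq0.
Qed.

HB.instance Definition _ := GRing.Zmodule_isComNzRing.Build {fps R}
  fps_mulA fps_mulC fps_mul1 fps_mulDl fps_one_neq0.

Lemma fps_coefM f g n : (f * g) n = \sum_(i < n.+1) f i * g (n - i)%N.
Proof. by []. Qed.

(* The multiplicative inverse of f when there is one, f otherwise. *)
Definition fps_unit : {pred {fps R}} := fun f => `[< exists g, g * f = 1 >].
Definition fps_inv f : {fps R} :=
  if pselect (exists g, g * f = 1) is left e then projT1 (cid e) else f.

Fact fps_mulVf : {in fps_unit, left_inverse 1 fps_inv *%R}.
Proof.
move=> f /asboolP ef; rewrite /fps_inv; case: pselect => // e.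
exact: projT2 (cid e).
Qed.
Fact fps_unitP f g : g * f = 1 -> f \in fps_unit.
Proof. by move=> gf; apply/asboolP; exists g. Qed.
Fact fps_inv_out : {in [predC fps_unit], fps_inv =1 id}.
Proof.
by move=> f /asboolP nf; rewrite /fps_inv; case: pselect.
Qed.

HB.instance Definition _ := GRing.ComNzRing_hasMulInverse.Build {fps R}
  fps_mulVf fps_unitP fps_inv_out.

Definition fpsC (c : R) : {fps R} := FPS (fun n => if n == 0%N then c else 0).
Definition fpsX : {fps R} := FPS (fun n => (n == 1%N)%:R).

Lemma fps_coefXM f n : (fpsX * f) n = if n is n'.+1 then f n' else 0.
Proof.
rewrite fps_coefM; case: n => [|n].
  by rewrite big_ord_recl big_ord0 /= mul0r addr0.
rewrite big_ord_recl big_ord_recl /= mul0r mul1r add0r big1 ?addr0 ?subn1 //.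
by move=> i _; rewrite mul0r.
Qed.

Lemma fps_coefXnM f a n :
  (fpsX ^+ a * f) n = if (n < a)%N then 0 else f (n - a)%N.
Proof.
elim: a n => [|a IH] n; first by rewrite expr0 mul1r subn0.
by rewrite exprS -mulrA fps_coefXM; case: n => // n; rewrite IH.
Qed.

Lemma fps_coefCM c f n : (fpsC c * f) n = c * f n.
Proof.
rewrite fps_coefM big_ord_recl /= subn0 big1 ?addr0 // => i _.
by rewrite mul0r.
Qed.

Lemma fpsCX c a : fpsC c ^+ a = fpsC (c ^+ a).
Proof.
elim: a => [|a IH]; first by apply: fpsP => -[].
apply: fpsP => n; rewrite !exprS IH fps_coefCM /=.
by case: eqP => // _; rewrite mulr0.
Qed.

Lemma fps_coef0_prod (I : Type) (r : seq I) (P : pred I) (F : I -> {fps R}) :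
  (\prod_(i <- r | P i) F i) 0%N = \prod_(i <- r | P i) F i 0%N.
Proof.
apply: (big_morph (fun f : {fps R} => f 0%N)) => // f g.
by rewrite fps_coefM big_ord_recl big_ord0 addr0.
Qed.

End FpsRing.
Arguments fpsX {R}.

Lemma fps_unit_coef0 (R : comUnitRingType) (f : {fps R}) :
  f 0%N \is a GRing.unit -> f \is a GRing.unit.
Proof.
move=> u0.
pose nxt (s : seq R) :=
  - (f 0%N)^-1 * \sum_(i < size s) s`_i * f (size s - i)%N.
pose gs := fix gs n := if n is n'.+1 then rcons (gs n') (nxt (gs n'))
                       else [:: (f 0%N)^-1].
have sz n : size (gs n) = n.+1 by elim: n => //= n IH; rewrite size_rcons IH.
pose g : {fps R} := FPS (fun n => (gs n)`_n).
have gsE n i : (i <= n)%N -> (gs n)`_i = g i.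
  elim: n => [|n IH] /=; first by rewrite leqn0 => /eqP->.
  rewrite leq_eqVlt => /orP[/eqP-> //|lt_in].
  by rewrite nth_rcons sz lt_in IH.
have gS n : g n.+1 = - (f 0%N)^-1 * \sum_(i < n.+1) g i * f (n.+1 - i)%N.
  rewrite /= nth_rcons sz ltnn eqxx /nxt sz; congr (_ * _).
  by apply: eq_bigr => i _; rewrite gsE // -ltnS.
have g0 : g 0%N = (f 0%N)^-1 by [].
clearbody g; clear gsE; apply/unitrPr; exists g; rewrite mulrC.
apply: fpsP => -[|n]; rewrite fps_coefM.
  by rewrite big_ord_recl big_ord0 addr0 g0 mulVr.
rewrite big_ord_recr /= subnn gS.
by rewrite mulrAC mulNr mulVr // mulN1r subrr.
Qed.

(* Z[[x, q]] is taken as Z[[q]][[x]]: F k N is the coefficient of x^k q^N. *)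
Notation fps2 := {fps {fps int}}.
Definition x : fps2 := fpsX.
Definition q : fps2 := fpsC fpsX.

(* A family is summable when it is locally finite, i.e. each monomial occurs
   in only finitely many members; its sum is then computed coefficientwise.
   A coefficient receiving infinitely many contributions is set to 0 by the
   finitely supported sum; the families summed below are proved summable. *)
Definition fps2_summable (I : choiceType) (A : set I) (F : I -> fps2) :=
  forall k N, finite_set (A `&` [set i | F i k N != 0])%classic.

Definition fps2_sum (I : choiceType) (A : set I) (F : I -> fps2) : fps2 :=
  FPS (fun k => FPS (fun N => \sum_(i \in A) F i k N)).

Notation "\fsum_ ( i '\in' A ) F" := (fps2_sum A (fun i => F))
  (at level 41, i binder, A at level 60, F at level 41,
   format "'[' \fsum_ ( i  '\in'  A ) '/  '  F ']'") : ring_scope.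

Definition fps2_dsum (F : nat -> nat -> fps2) : fps2 :=
  \fsum_(mn \in [set: nat * nat]%classic) F mn.1 mn.2.

Notation "\dsum_ ( m , n ) F" := (fps2_dsum (fun m n => F))
  (at level 41, m name, n name, F at level 41,
   format "'[' \dsum_ ( m ,  n ) '/  '  F ']'") : ring_scope.

Definition qpoch (R : comNzRingType) (a b : R) (k : nat) : R :=
  \prod_(0 <= i < k) (1 - a * b ^+ i).

Definition is_partition (p : seq nat) : bool :=
  all (fun l => 0 < l)%N p && sorted leq p.

(* lG i: parts are listed in non-decreasing order, b is preceded by a. *)
Definition lG (i : nat) : set (seq nat) :=
  [set p | [&& is_partition p, all (fun l => i <= l)%N p &
            sorted (fun a b => (a + 2 <= b)%N && (odd b ==> (a + 3 <= b)%N))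
                   p]]%classic.

Definition L (m n : nat) : nat :=
  (3 * ((m ^ 2 + m) %/ 2) + 2 * n * m + n ^ 2 + n)%N.

Lemma qpoch_unit s t k : (0 < s)%N -> qpoch (q ^+ s) (q ^+ t) k \is a GRing.unit.
Proof.
move=> s0; do 2 apply: fps_unit_coef0.
rewrite fps_coef0_prod fps_coef0_prod big1 ?unitr1 // => i _.
rewrite -exprM -exprD fpsCX /= -[fpsX ^+ _]mulr1 fps_coefXnM ifT ?subr0 //.
by rewrite addn_gt0 s0.
Qed.

Lemma summable_partitions i :
  fps2_summable (lG i) (fun p => x ^+ size p * q ^+ sumn p).
Proof.
move=> k N.
have fin n : finite_set [set p : seq nat | (size p <= n)%N && all (leq^~ N) p]%classic.
  elim: n => [|n IH].
    apply: (@sub_finite_set _ _ [set [::]]%classic); last exact: finite_set1.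
    by move=> p /= /andP[]; rewrite leqn0 size_eq0 => /eqP.
  have fX := finite_image (fun z : nat * seq nat => z.1 :: z.2)
    (finite_setX (finite_II N.+1) IH).
  have f1 := finite_set1 ([::] : seq nat).
  have fU := conj f1 fX; rewrite -finite_setU in fU; apply: sub_finite_set fU.
  move=> [|a p] /=; first by left.
  case/andP=> sp /andP[aN pN]; right.
  by exists (a, p) => //=; rewrite pN andbT; split.
apply: sub_finite_set (fin k) => p [_].
rewrite /mkset fps_coefXnM fpsCX; case: ltnP => [_|le_k /=]; first by rewrite eqxx.
have pN : (sumn p <= N)%N -> all (leq^~ N) p.
  elim: p {le_k} => //= a p IH h.
  by rewrite (leq_trans (leq_addr _ _) h) IH // (leq_trans (leq_addl _ _) h).
case: ifP => _; last by rewrite eqxx.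
rewrite -[fpsX ^+ _]mulr1 fps_coefXnM.
by case: ltnP => [_|/pN]; rewrite ?eqxx.
Qed.

Lemma summable_double (c : nat) (F : nat -> nat -> fps2) :
  fps2_summable [set: nat * nat]%classic
    (fun mn => x ^+ (mn.1 + mn.2 + c) * F mn.1 mn.2).
Proof.
move=> k N.
apply: sub_finite_set (finite_setX (finite_II k.+1) (finite_II k.+1)).
move=> [m n] [_]; rewrite /mkset fps_coefXnM; case: ltnP => [_|le_k _].
  by rewrite eqxx.
split; rewrite /= ltnS; apply: leq_trans le_k => /=.
  by rewrite -addnA leq_addr.
by rewrite -addnA addnCA leq_addr.
Qed.

(* Main.v *)
(* Let G be the generating function of lG 2.  Splitting off the smallest part
   (2 or 3) and shifting the remaining parts down by 2 gives
     G(x) = (1 + x q^2) G(x q^2) + x q^3 G(x q^4),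
   a first-order recurrence for the coefficients of x^k.  On the other side,
   L(m, n) = k^2 + k + m(m+1)/2 with k = m + n, so up to the factor q^(k^2+k) the
   coefficient of x^k in the double sum is that of A(x) B(x), where
     A(x) = (-x q; q)_oo            satisfies A(x) = (1 + x q) A(x q),
     B(x) = (1 + x) / (x^2; q^4)_oo satisfies
            (1 - x)(1 + x q^2) B(x) = B(x q^2).
   Hence (1 - x) A(x) B(x) = (1 + x q) A(x q^2) B(x q^2), which yields the same
   recurrence.  A partition in lG 1 is in lG 2 or is 1 followed by an element of
   lG 4, i.e. by an element of lG 2 shifted by 2. *)
Require Import Defs.
From HB Require Import structures.
From mathcomp Require Import all_boot all_order all_algebra.
From mathcomp Require Import boolp classical_sets functions cardinality fsbigop.
From mathcomp Require Import zify ring.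

Set Implicit Arguments.
Unset Strict Implicit.

Import GRing.Theory.
Local Open Scope ring_scope.

(** * Dilation of formal power series *)

Section PowerSeries.
Variable R : comNzRingType.
Implicit Types (c : R) (f g : {fps R}).

Lemma fps_coefD f g n : (f + g) n = f n + g n. Proof. by []. Qed.
Lemma fps_coefB f g n : (f - g) n = f n - g n. Proof. by []. Qed.

Lemma fps_coef_sum (I : Type) (r : seq I) (F : I -> {fps R}) n :
  (\sum_(i <- r) F i) n = \sum_(i <- r) F i n.
Proof. exact: (big_morph (fun f : {fps R} => f n)). Qed.

Fact fpsC_zmod_morphism : zmod_morphism (@fpsC R).
Proof. by move=> a b; apply: fpsP => -[|n] //=; rewrite oppr0 addr0. Qed.
HB.instance Definition _ :=
  GRing.isZmodMorphism.Build R {fps R} (@fpsC R) fpsC_zmod_morphism.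

Fact fpsC_monoid_morphism : monoid_morphism (@fpsC R).
Proof.
split=> [|a b]; apply: fpsP => -[|n] //; rewrite fps_coefCM //=.
by rewrite mulr0.
Qed.
HB.instance Definition _ :=
  GRing.isMonoidMorphism.Build R {fps R} (@fpsC R) fpsC_monoid_morphism.

(* The substitution X := c X. *)
Definition fps_dil c f : {fps R} := FPS (fun n => c ^+ n * f n).

Fact fps_dil_zmod_morphism c : zmod_morphism (fps_dil c).
Proof. by move=> f g; apply: fpsP => n /=; rewrite mulrBr. Qed.
HB.instance Definition _ c :=
  GRing.isZmodMorphism.Build {fps R} {fps R} (fps_dil c)
    (fps_dil_zmod_morphism c).

Fact fps_dil_monoid_morphism c : monoid_morphism (fps_dil c).
Proof.
split=> [|f g]; apply: fpsP => n.
  by case: n => [|n] /=; rewrite (mulr1, mulr0).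
rewrite /= mulr_sumr; apply: eq_bigr => i _ /=.
by rewrite mulrACA -exprD subnKC // -ltnS.
Qed.
HB.instance Definition _ c :=
  GRing.isMonoidMorphism.Build {fps R} {fps R} (fps_dil c)
    (fps_dil_monoid_morphism c).

Lemma fps_coef_dil c f n : fps_dil c f n = c ^+ n * f n. Proof. by []. Qed.

Lemma fps_dilC c a : fps_dil c (fpsC a) = fpsC a.
Proof. by apply: fpsP => -[|n] /=; rewrite (mul1r, mulr0). Qed.

Lemma fps_dilX c : fps_dil c fpsX = fpsC c * fpsX.
Proof.
apply: fpsP => n; rewrite fps_coefCM /=.
by case: n => [|[|n]]; rewrite ?expr1 // !mulr0.
Qed.

Lemma fps_dil_dil c d f : fps_dil c (fps_dil d f) = fps_dil (c * d) f.
Proof. by apply: fpsP => n /=; rewrite exprMn mulrA. Qed.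

Lemma fps_dil_monom c a n :
  fps_dil c (fpsX ^+ n * fpsC a) = fpsX ^+ n * fpsC (c ^+ n * a).
Proof.
rewrite rmorphM rmorphXn /= fps_dilX fps_dilC exprMn fpsCX rmorphM /=.
by rewrite mulrA; congr (_ * _); rewrite mulrC.
Qed.

End PowerSeries.

Local Notation Q := (fpsX : {fps int}).

Lemma fpsX_sub1_unit s : (0 < s)%N -> 1 - Q ^+ s \is a GRing.unit.
Proof.
move=> s0; apply: fps_unit_coef0; rewrite fps_coefB.
by rewrite -[Q ^+ s]mulr1 fps_coefXnM s0 subr0.
Qed.

Lemma qpochS (R : comNzRingType) (a b : R) k :
  qpoch a b k.+1 = qpoch a b k * (1 - a * b ^+ k).
Proof. by rewrite /qpoch big_nat_recr. Qed.

Lemma rmorph_qpoch (R S : comNzRingType) (f : {rmorphism R -> S}) a b k :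
  f (qpoch a b k) = qpoch (f a) (f b) k.
Proof.
rewrite /qpoch rmorph_prod; apply: eq_bigr => i _.
by rewrite rmorphB rmorph1 rmorphM rmorphXn.
Qed.

Lemma qpoch_fpsX_unit s t k :
  (0 < s)%N -> qpoch (Q ^+ s) (Q ^+ t) k \is a GRing.unit.
Proof.
move=> s0; elim: k => [|k IH]; first by rewrite /qpoch big_geq ?unitr1.
by rewrite qpochS unitrM IH -exprM -exprD fpsX_sub1_unit // addn_gt0 s0.
Qed.

(** * The two factors and their product *)

(* Euler's expansion of (-x q; q)_oo. *)
Definition distinct_series : fps2 :=
  FPS (fun m => Q ^+ ((m ^ 2 + m) %/ 2) / qpoch Q Q m).

(* The expansion of (1 + x) / (x^2; q^4)_oo. *)
Definition doubled_series : fps2 :=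
  FPS (fun n => (qpoch (Q ^+ 4) (Q ^+ 4) (n %/ 2))^-1).

Lemma distinct_series0 : distinct_series 0%N = 1.
Proof. by rewrite /= /qpoch big_geq // invr1 mulr1. Qed.

(** The triangular exponent grows by [m.+1], and the denominator gains the factor
    [1 - Q ^+ m.+1]. *)
Lemma distinct_seriesS m :
  distinct_series m.+1 * (1 - Q ^+ m.+1) = Q ^+ m.+1 * distinct_series m.
Proof.
rewrite /= qpochS -exprS invrM ?fpsX_sub1_unit //; last first.
  exact: (@qpoch_fpsX_unit 1 1).
rewrite mulrA mulrAC mulrA mulrK ?fpsX_sub1_unit // -exprD.
congr (_ ^+ _ / _).
have -> : (m.+1 ^ 2 + m.+1 = m.+1 * 2 + (m ^ 2 + m))%N by lia.
by rewrite divnMDl.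
Qed.

Lemma distinct_series_dil :
  distinct_series = (1 + q * x) * fps_dil Q distinct_series.
Proof.
apply: fpsP => -[|m]; rewrite mulrDl mul1r -mulrA fps_coefD fps_coefCM fps_coefXM.
  by rewrite mulr0 addr0 fps_coef_dil mul1r.
have := distinct_seriesS m; set a := distinct_series _; set b := distinct_series _.
move=> e; rewrite !fps_coef_dil -/a -/b mulrA -exprS -e; ring.
Qed.

Lemma doubled_series0 : doubled_series 0%N = 1.
Proof. by rewrite /= /qpoch big_geq ?invr1. Qed.

Lemma doubled_series_odd j :
  doubled_series j.*2.+1 = doubled_series j.*2.
Proof. by rewrite /=; congr ((qpoch _ _ _)^-1); lia. Qed.

Lemma doubled_series_even j :
  doubled_series j.*2 = doubled_series j.+1.*2 * (1 - Q ^+ (4 * j.+1)).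
Proof.
rewrite /= !divn2 !doubleK qpochS -exprM -exprD -mulnS.
rewrite invrM ?fpsX_sub1_unit ?qpoch_fpsX_unit // mulrAC.
by rewrite mulVr ?mul1r ?fpsX_sub1_unit.
Qed.

Lemma doubled_series_dil :
  (1 - x) * (1 + q ^+ 2 * x) * doubled_series = fps_dil (Q ^+ 2) doubled_series.
Proof.
(* Written as [1 - (1 - q^2) x - q^2 x^2], the factor combines three consecutive coefficients; which
   of them coincide depends on the parity of the index. *)
have -> : (1 - x) * (1 + q ^+ 2 * x) * doubled_series = doubled_series
    - fpsC (1 - Q ^+ 2) * (x * doubled_series)
    - fpsC (Q ^+ 2) * (x * (x * doubled_series)).
  by rewrite rmorphB rmorph1 rmorphXn -/q; ring.
have b0 := doubled_series0.
have bo := doubled_series_odd; have be := doubled_series_even.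
apply: fpsP => n; rewrite fps_coef_dil; move: b0 bo be.
move: doubled_series => b b0 bo be; rewrite !fps_coefB !fps_coefCM.
have bx j : (x * b) j.+1.*2 = b j.*2 by rewrite fps_coefXM doubleS bo.
have bx1 j : (x * (x * b)) j.+1.*2.+1 = b j.*2 by rewrite fps_coefXM bx.
have bx2 j : (x * (x * b)) j.+1.*2 = b j.*2.
  by rewrite fps_coefXM doubleS fps_coefXM.
rewrite -(odd_double_half n); case: (odd n); case: (n./2) => [|j].
- by rewrite add1n !fps_coefXM double0 (bo 0%N) b0 expr1; ring.
- rewrite add1n bx1 fps_coefXM bo (be j) -exprM.
  have -> : (2 * j.+1.*2.+1 = 2 + 4 * j.+1)%N by lia.
  by rewrite exprD; ring.
- by rewrite add0n double0 !fps_coefXM b0; ring.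
- rewrite add0n bx2 bx (be j) -exprM.
  have -> : (2 * j.+1.*2 = 4 * j.+1)%N by lia.
  by ring.
Qed.

Definition prod_series : fps2 := distinct_series * doubled_series.

Lemma prod_series_dil :
  (1 - x) * prod_series = (1 + q * x) * fps_dil (Q ^+ 2) prod_series.
Proof.
have u : 1 + q ^+ 2 * x \is a GRing.unit.
  apply: fps_unit_coef0; rewrite fps_coefD /q fpsCX fps_coefCM mulr0 addr0.
  exact: unitr1.
(* Dilating by [Q] twice matches the dilation by [Q ^+ 2] in [doubled_series_dil]. *)
have a2 : distinct_series
    = (1 + q * x) * (1 + q ^+ 2 * x) * fps_dil (Q ^+ 2) distinct_series.
  rewrite {1}distinct_series_dil {1}distinct_series_dil.
  rewrite rmorphM rmorphD rmorph1 rmorphM.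
  rewrite /= /q /x fps_dilC fps_dilX fps_dil_dil -expr2; ring.
rewrite /prod_series rmorphM /= -doubled_series_dil.
apply: (mulrI u); rewrite {1}a2; ring.
Qed.

(** Compare coefficients of [x ^+ k.+1] in [prod_series_dil]. *)
Lemma prod_seriesS k :
  (1 - Q ^+ (2 * k.+1)) * prod_series k.+1
  = (1 + Q ^+ (2 * k).+1) * prod_series k.
Proof.
have /(congr1 (fun f : fps2 => f k.+1)) := prod_series_dil.
rewrite !mulrDl !mul1r mulNr -mulrA fps_coefB fps_coefD fps_coefCM !fps_coefXM.
rewrite !fps_coef_dil -!exprM [Q ^+ (2 * k).+1]exprS.
move: (prod_series k) (prod_series k.+1) => b a.
by move=> /eqP; rewrite subr_eq => /eqP e; rewrite {1}e; ring.
Qed.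

(** * Coefficientwise sums of families *)

Lemma fps_coef_monomM a b (F : fps2) k N :
  (x ^+ a * q ^+ b * F) k N =
  if (a <= k)%N && (b <= N)%N then F (k - a)%N (N - b)%N else 0.
Proof.
rewrite -mulrA fps_coefXnM /q fpsCX; case: ltnP => // _.
rewrite fps_coefCM fps_coefXnM.
by case: ltnP.
Qed.

Lemma fps_coef_dil2 a (F : fps2) k N :
  fps_dil (Q ^+ a) F k N =
  if (a * k <= N)%N then F k (N - a * k)%N else 0.
Proof. by rewrite fps_coef_dil -exprM fps_coefXnM; case: ltnP. Qed.

Section Fps2Sum.
Variable I : choiceType.
Implicit Types (A B : set I) (F : I -> fps2).

Lemma fps2_sum_coef A F k N :
  fps2_sum A F k N = \sum_(i \in A) F i k N.
Proof. by []. Qed.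

Lemma eq_fps2_sum A F G : F =1 G -> fps2_sum A F = fps2_sum A G.
Proof. by move=> /funext ->. Qed.

(** A monomial factor only moves coefficients, so both sides also agree where an infinite support
    sends the sum to 0. *)
Lemma fps2_sum_monomM A F a b :
  fps2_sum A (fun i => x ^+ a * q ^+ b * F i) = x ^+ a * q ^+ b * fps2_sum A F.
Proof.
apply: fpsP => k; apply: fpsP => N; rewrite fps_coef_monomM !fps2_sum_coef.
under eq_fsbigr => i _ do rewrite fps_coef_monomM.
by case: ifP => // _; rewrite fsbig1.
Qed.

Lemma fps2_sum_dil A F a :
  fps2_sum A (fun i => fps_dil (Q ^+ a) (F i))
  = fps_dil (Q ^+ a) (fps2_sum A F).
Proof.
apply: fpsP => k; apply: fpsP => N; rewrite fps_coef_dil2 !fps2_sum_coef.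
under eq_fsbigr => i _ do rewrite fps_coef_dil2.
by case: ifP => // _; rewrite fsbig1.
Qed.

(** Summability excludes the default value 0 of a sum with infinite support, which could break
    additivity. *)
Lemma fps2_sum_setU A B F : fps2_summable A F -> fps2_summable B F ->
  (A `&` B `<=` set0)%classic ->
  fps2_sum (A `|` B)%classic F = fps2_sum A F + fps2_sum B F.
Proof.
move=> sA sB AB0; apply: fpsP => k; apply: fpsP => N.
rewrite !fps_coefD !fps2_sum_coef fsbig_supp setIUl fsbigU0.
- by rewrite -!fsbig_supp.
- by apply: sub_finite_set (sA k N) => i [Ai /eqP].
- by apply: sub_finite_set (sB k N) => i [Bi /eqP].
- by move=> i [[Ai _] [Bi _]]; apply: AB0.
Qed.

End Fps2Sum.

Lemma fps2_sum_image (I J : choiceType) (A : set I) (h : I -> J)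
    (F : J -> fps2) :
  injective h -> fps2_sum (h @` A)%classic F = fps2_sum A (F \o h).
Proof.
move=> inj_h; apply: fpsP => k; apply: fpsP => N; rewrite !fps2_sum_coef.
by rewrite fsbig_image // => i j _ _; apply: inj_h.
Qed.

Lemma fps2_dsum_coef (u : nat -> nat -> {fps int}) k :
  fps2_dsum (fun m n => x ^+ (m + n) * fpsC (u m n)) k
  = \sum_(i < k.+1) u i (k - i)%N.
Proof.
apply: fpsP => N; rewrite fps_coef_sum /fps2_dsum fps2_sum_coef.
(* Only the antidiagonal [m + n = k] contributes, because [fpsC] is constant in [x]. *)
rewrite (@fsbigE _ _ _ _ _ [seq (i, (k - i)%N) | i <- iota 0 k.+1]).
- rewrite big_map -[iota 0 k.+1]/(index_iota 0 k.+1) big_mkord.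
  apply: eq_big => i; rewrite in_setT // => _.
  have ik : (i <= k)%N by rewrite -ltnS.
  by rewrite [(_, _).1]/= [(_, _).2]/= subnKC // fps_coefXnM ltnn subnn.
- by rewrite map_inj_uniq ?iota_uniq // => i j [].
- by [].
- move=> [m n] _ /mapP mnr; rewrite fps_coefXnM /=; case: ltnP => // le_k.
  case: eqP => // /eqP; rewrite subn_eq0 => ge_k; case: mnr.
  by exists m; rewrite ?mem_iota; [lia | congr pair; lia].
Qed.

(** * The double sum *)

Definition double_term m n : {fps int} :=
  Q ^+ L m n / (qpoch Q Q m * qpoch (Q ^+ 4) (Q ^+ 4) (n %/ 2)).

(** The denominator is constant in [x] and a unit already in Z[[q]], so the morphism [fpsC] commutes
    with the division. *)
Lemma double_termE m n (F : fps2) :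
  F * q ^+ L m n / (qpoch q q m * qpoch (q ^+ 4) (q ^+ 4) (n %/ 2))
  = F * fpsC (double_term m n).
Proof.
rewrite /double_term rmorphM rmorphXn rmorphV; last first.
  rewrite unitrM; apply/andP; split; first exact: (@qpoch_fpsX_unit 1 1).
  exact: qpoch_fpsX_unit.
rewrite rmorphM mulrA; congr (_ / (_ * _)); first exact/esym/rmorph_qpoch.
by rewrite rmorph_qpoch rmorphXn.
Qed.

Lemma L_addE m n :
  L m n = ((m + n) ^ 2 + (m + n) + (m ^ 2 + m) %/ 2)%N.
Proof.
(* Evenness makes the integer division in [L] exact. *)
have /dvdnP[t e] : (2 %| m ^ 2 + m)%N by rewrite dvdn2 oddD oddX addbb.
by rewrite /L e mulnK // sqrnD; lia.
Qed.

Lemma double_termM m n :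
  double_term m n =
  Q ^+ ((m + n) ^ 2 + (m + n)) * (distinct_series m * doubled_series n).
Proof.
have u : qpoch Q Q m \is a GRing.unit by exact: (@qpoch_fpsX_unit 1 1).
have v : qpoch (Q ^+ 4) (Q ^+ 4) (n %/ 2) \is a GRing.unit.
  exact: qpoch_fpsX_unit.
rewrite /double_term L_addE exprD (invrM u v).
rewrite [distinct_series m]/= [doubled_series n]/=.
by rewrite -mulrA [_ / qpoch Q Q m]mulrC -[in RHS]mulrA.
Qed.

Definition double_sum : fps2 :=
  fps2_dsum (fun m n => x ^+ (m + n) * fpsC (double_term m n)).

(** The power of [Q] is constant on [m + n = k]; what remains is a Cauchy product. *)
Lemma double_sum_coef k : double_sum k = Q ^+ (k ^ 2 + k) * prod_series k.
Proof.
rewrite fps2_dsum_coef fps_coefM mulr_sumr; apply: eq_bigr => i _.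
by rewrite double_termM subnKC // -ltnS.
Qed.

Lemma double_sumS k :
  (1 - Q ^+ (2 * k.+1)) * double_sum k.+1
  = (Q ^+ (2 * k.+1) + Q ^+ (4 * k + 3)) * double_sum k.
Proof.
rewrite !double_sum_coef mulrCA prod_seriesS.
have -> : (k.+1 ^ 2 + k.+1 = (k ^ 2 + k) + 2 * k.+1)%N by lia.
have -> : (4 * k + 3 = 2 * k.+1 + (2 * k).+1)%N by lia.
by rewrite !exprD; ring.
Qed.

(** * Partitions and their generating functions *)

Definition lG_series i : fps2 :=
  \fsum_(p \in lG i) (x ^+ size p * q ^+ sumn p).

(* By parity, the least part allowed after a depends on a only: a + 2 if a is
   even, a + 3 if a is odd. *)
Definition lG_rel (a b : nat) : bool := (a + 2 + odd a <= b)%N.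

Lemma lG_rel_trans : transitive lG_rel.
Proof. by move=> b a c; rewrite /lG_rel; lia. Qed.

(** The bound [0 < i] gives positivity of the parts, and the gap condition already forces their
    order. *)
Lemma lGE i p : (0 < i)%N ->
  lG i p = (all (leq i) p && sorted lG_rel p).
Proof.
move=> i0; rewrite /lG /mkset /is_partition; congr is_true.
have -> : sorted (fun a b => (a + 2 <= b)%N && (odd b ==> (a + 3 <= b)%N)) p
    = sorted lG_rel p.
  by apply: eq_sorted => a b; rewrite /lG_rel; lia.
apply/and3P/andP => [[_ ip sp] // | [ip sp]]; split=> //; apply/andP; split.
  by apply: sub_all ip => l; apply: leq_trans.
by apply: sub_sorted sp => a b; rewrite /lG_rel; lia.
Qed.

(** By transitivity of [lG_rel] the gap after [a] bounds every later part, so the tails again form a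
    set [lG j]. *)
Lemma lG_cons i a p : (0 < i)%N ->
  lG i (a :: p) <-> (i <= a)%N /\ lG (a + 2 + odd a) p.
Proof.
move=> i0; rewrite !lGE ?addn_gt0 ?orbT //= (path_sortedE lG_rel_trans) andbA.
split=> [/andP[/andP[/andP[ia _] ap] sp] | [ia /andP[ap sp]]].
  by split=> //; apply/andP.
rewrite ia sp /= andbT; apply/andP; split=> //.
by apply: sub_all ap => b; lia.
Qed.

Lemma lG_first_part i : (0 < i)%N ->
  lG i = (lG i.+1 `|` cons i @` lG (i + 2 + odd i))%classic.
Proof.
move=> i0; apply/seteqP; split=> [[|a p] | p [|[{}p ip <-]]].
- by left; rewrite lGE.
- move=> /(lG_cons _ _ i0) [ia ap]; have [e|ne] := eqVneq a i.
    by right; exists p; rewrite ?e // -e.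
  by left; apply/lG_cons => //; split=> //; lia.
- case: p => [|a p]; first by rewrite !lGE.
  move=> /lG_cons [] // ia ap; apply/lG_cons => //; split=> //; lia.
- by apply/lG_cons.
Qed.

(** A shift by 2 preserves parity, hence the gap condition. *)
Lemma lG_shift i : (0 < i)%N -> lG (i + 2) = (map (addn 2) @` lG i)%classic.
Proof.
move=> i0; have e p : lG (i + 2) (map (addn 2) p) = lG i p.
  rewrite !lGE ?addn_gt0 ?orbT // all_map sorted_map; congr (is_true (_ && _)).
    by apply: eq_all => b; rewrite /=; lia.
  by apply: eq_sorted => a b; rewrite /= /lG_rel oddD; lia.
apply/seteqP; split=> [p ip | _ [p ip <-]]; last by rewrite e.
have pE : map (addn 2) (map (subn^~ 2) p) = p.
  rewrite -map_comp map_id_in // => b bp; rewrite /= subnKC //.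
  by move: ip; rewrite lGE ?addn_gt0 ?orbT // => /andP[/allP/(_ b bp)]; lia.
by exists (map (subn^~ 2) p); rewrite // -e pE.
Qed.

Lemma lG_seriesS i : (0 < i)%N ->
  lG_series i = lG_series i.+1 + x * q ^+ i * lG_series (i + 2 + odd i).
Proof.
move=> i0; rewrite /lG_series lG_first_part // fps2_sum_setU.
- congr (_ + _); rewrite fps2_sum_image => [|p p' [] //].
  rewrite -[x in RHS]expr1 -fps2_sum_monomM; apply: eq_fps2_sum => p /=.
  by rewrite exprS exprD; ring.
- exact: summable_partitions.
(* The image under [cons i] inherits summability from [lG i], which contains it. *)
- move=> k N; apply: sub_finite_set (summable_partitions i k N) => p [pi pN].
  by split=> //; rewrite lG_first_part //; right.
- by move=> _ [/[swap] [[p _ <-]]] /lG_cons [] //; rewrite ltnn.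
Qed.

(** Each part raised by 2 contributes a factor [q ^+ 2], which amounts to replacing [x] by
    [q ^+ 2 * x]. *)
Lemma lG_series_shift i : (0 < i)%N ->
  lG_series (i + 2) = fps_dil (Q ^+ 2) (lG_series i).
Proof.
move=> i0; rewrite /lG_series lG_shift // fps2_sum_image; last first.
  by apply: inj_map; apply: addnI.
rewrite -fps2_sum_dil; apply: eq_fps2_sum => p /=.
rewrite /x /q !fpsCX fps_dil_monom size_map -exprM -exprD; congr (_ * _).
by congr (fpsC (Q ^+ _)); elim: p => //= a p ->; lia.
Qed.

(** Split off a least part 2, then a least part 3; the tails lie in [lG 4] and [lG 6], the shifts of
    [lG 2] by 2 and 4. *)
Lemma lG_series2_dil (G := lG_series 2) :
  G = fps_dil (Q ^+ 2) G + x * q ^+ 2 * fps_dil (Q ^+ 2) G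
      + x * q ^+ 3 * fps_dil (Q ^+ 4) G.
Proof.
have G4 : lG_series 4 = fps_dil (Q ^+ 2) G by rewrite -(@lG_series_shift 2).
have G6 : lG_series 6 = fps_dil (Q ^+ 4) G.
  rewrite -[6%N]/(4 + 2)%N lG_series_shift // G4 fps_dil_dil.
  by rewrite -exprD.
have G3 : lG_series 3 = fps_dil (Q ^+ 2) G + x * q ^+ 3 * fps_dil (Q ^+ 4) G.
  rewrite lG_seriesS //; congr (_ + _ * _); [exact: G4 | exact: G6].
rewrite addrAC; transitivity (lG_series 3 + x * q ^+ 2 * lG_series 4).
  exact: lG_seriesS.
congr (_ + _ * _); [exact: G3 | exact: G4].
Qed.

Lemma fps_coef_xqM a (F : fps2) k : (x * q ^+ a * F) k.+1 = Q ^+ a * F k.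
Proof. by rewrite -mulrA fps_coefXM /q fpsCX fps_coefCM. Qed.

Lemma lG_series2S k (G := lG_series 2) :
  (1 - Q ^+ (2 * k.+1)) * G k.+1
  = (Q ^+ (2 * k.+1) + Q ^+ (4 * k + 3)) * G k.
Proof.
have coefS a b (A B : fps2) : (A + x * q ^+ a * A + x * q ^+ b * B) k.+1
    = A k.+1 + Q ^+ a * A k + Q ^+ b * B k by rewrite !fps_coefD !fps_coef_xqM.
have /(congr1 (fun f : fps2 => f k.+1)) := lG_series2_dil.
rewrite coefS !fps_coef_dil -!exprM -/G.
have -> : (4 * k + 3 = 3 + 4 * k)%N by lia.
rewrite mulnS !exprD.
by move: (G k) (G k.+1) => b a e; rewrite mulrBl mul1r {1}e; ring.
Qed.

Lemma lG_series2_coef0 : lG_series 2 0%N = 1.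
Proof.
apply: fpsP => N; rewrite /lG_series fps2_sum_coef.
rewrite -(@fsbig_widen _ _ _ _ [set [::]]%classic).
- by rewrite fsbig_set1 mulr1.
- by move=> _ ->; rewrite lGE.
- move=> [|a p] [_]; first by case.
  by move=> _; rewrite /preimage /mkset fps_coefXnM.
Qed.

Lemma lG_series2E : lG_series 2 = double_sum.
Proof.
apply: fpsP; elim=> [|k IH].
  rewrite lG_series2_coef0 double_sum_coef fps_coefM big_ord_recl big_ord0 addr0.
  by rewrite distinct_series0 doubled_series0 !mulr1.
(* Both sides obey the same recurrence, whose leading factor is a unit. *)
apply: (mulrI (@fpsX_sub1_unit (2 * k.+1) isT)).
by rewrite lG_series2S double_sumS IH.
Qed.

Theorem theorem4p2 :
  (\fsum_(p \in lG 1) (x ^+ size p * q ^+ sumn p)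
   = \dsum_(m, n) (x ^+ (m + n) * q ^+ L m n
                   / (qpoch q q m * qpoch (q ^+ 4) (q ^+ 4) (n %/ 2)))
   + \dsum_(m, n) (x ^+ (m + n + 1) * q ^+ (L m n + 2 * m + 2 * n + 1)
                   / (qpoch q q m * qpoch (q ^+ 4) (q ^+ 4) (n %/ 2))))
  /\
  (\fsum_(p \in lG 2) (x ^+ size p * q ^+ sumn p)
   = \dsum_(m, n) (x ^+ (m + n) * q ^+ L m n
                   / (qpoch q q m * qpoch (q ^+ 4) (q ^+ 4) (n %/ 2)))).
Proof.
rewrite -/(lG_series 1) -/(lG_series 2).
set S := fps2_dsum _; set S' := fps2_dsum _.
have -> : S = double_sum.
  by apply: eq_fps2_sum => -[m n]; rewrite double_termE.
(* The extra exponent [2 * m + 2 * n] is what the dilation puts on [x ^+ (m + n)]. *)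
have -> : S' = x * q * fps_dil (Q ^+ 2) double_sum.
  rewrite -[x in RHS]expr1 -[q in RHS]expr1 /double_sum /fps2_dsum.
  rewrite -fps2_sum_dil -fps2_sum_monomM; apply: eq_fps2_sum => -[m n] /=.
  have -> : (L m n + 2 * m + 2 * n + 1 = 2 * (m + n) + 1 + L m n)%N by lia.
  rewrite [q ^+ (_ + L m n)]exprD mulrA double_termE /x fps_dil_monom -/x.
  rewrite -exprM [fpsC (_ * _)]rmorphM /= -fpsCX -/q !exprD.
  by move: (fpsC _) => t; ring.
split; last exact: lG_series2E.
(* After a part 1 the bound is [1 + 2 + odd 1 = 4], so the tails form [lG 4]. *)
by rewrite lG_seriesS // (@lG_series_shift 2) // lG_series2E expr1.
Qed.
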